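(* Over $\mathsf{RCA}_0$, $\mathsf{EM}_\times$ and $\mathsf{fEM}_{<\infty}$ are equivalent.
   Context: $\mathbb{N}$ denotes the first-order universe; $[0,a]=\{0,\dots,a\}$. A coloring $c:[S]^2\to[0,a]$ is \emph{transitive} if for all $x<y<z$ in $S$ with $c(x,y)=c(y,z)$ we have $c(x,z)=c(x,y)$; it is \emph{fallow} if for all $x<y<z$ in $S$, $c(x,z)\in\{c(x,y),c(y,z)\}$. $\mathsf{EM}_\times$: whenever $\{c_i\}_{i\le a}$ is a finite sequence of colorings $c_i:[\mathbb{N}]^2\to\{0,1\}$, there is an infinite $S\subseteq\mathbb{N}$ such that every $c_i\upharpoonright[S]^2$ is transitive. $\mathsf{fEM}_{<\infty}$: for every $a$ and every $c:[\mathbb{N}]^2\to[0,a]$ there is an infinite $S\subseteq\mathbb{N}$ with $c\upharpoonright[S]^2$ fallow. *)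

(* Defs.v *)
(* Stdlib/vanilla world.  Semantic (Henkin-model) rendering of
   "over RCA_0, P and Q are equivalent": in every model of RCA_0
   (by Goedel completeness this is the same as RCA_0 |- P <-> Q). *)

Record L2structure := {
  Num : Type;
  SetT : Type;
  zero : Num;
  one : Num;
  add : Num -> Num -> Num;
  mul : Num -> Num -> Num;
  lt : Num -> Num -> Prop;
  mem : Num -> SetT -> Prop
}.

(** * Syntax of L2 formulas (number quantifiers only; free set parameters).
    Number variables and set variables are de Bruijn indices. *)
Inductive term : Type :=
| tvar (n : nat)
| tzero
| tone
| tplus (a b : term)
| ttimes (a b : term).

Inductive form : Type :=
| feq (a b : term)
| flt (a b : term)
| fmem (a : term) (k : nat)
| fnot (f : form)
| fand (f g : form)
| f_or (f g : form)
| fimp (f g : form)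
| fall (f : form)
| fex (f : form)
| fball (t : term) (f : form)          (* forall n < t, f  (t in outer context) *)
| fbex (t : term) (f : form).

Definition scons {A : Type} (x : A) (e : nat -> A) : nat -> A :=
  fun n => match n with O => x | S m => e m end.

Section Sem.
Variable M : L2structure.

Fixpoint evalt (e : nat -> Num M) (t : term) : Num M :=
  match t with
  | tvar n => e n
  | tzero => zero M
  | tone => one M
  | tplus a b => add M (evalt e a) (evalt e b)
  | ttimes a b => mul M (evalt e a) (evalt e b)
  end.

Fixpoint sat (e : nat -> Num M) (E : nat -> SetT M) (f : form) : Prop :=
  match f with
  | feq a b => evalt e a = evalt e b
  | flt a b => lt M (evalt e a) (evalt e b)
  | fmem a k => mem M (evalt e a) (E k)
  | fnot f => ~ sat e E f
  | fand f g => sat e E f /\ sat e E g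
  | f_or f g => sat e E f \/ sat e E g
  | fimp f g => sat e E f -> sat e E g
  | fall f => forall x, sat (scons x e) E f
  | fex f => exists x, sat (scons x e) E f
  | fball t f => forall x, lt M x (evalt e t) -> sat (scons x e) E f
  | fbex t f => exists x, lt M x (evalt e t) /\ sat (scons x e) E f
  end.

End Sem.

Inductive Bounded : form -> Prop :=
| B_eq a b : Bounded (feq a b)
| B_lt a b : Bounded (flt a b)
| B_mem a k : Bounded (fmem a k)
| B_not f : Bounded f -> Bounded (fnot f)
| B_and f g : Bounded f -> Bounded g -> Bounded (fand f g)
| B_or f g : Bounded f -> Bounded g -> Bounded (f_or f g)
| B_imp f g : Bounded f -> Bounded g -> Bounded (fimp f g)
| B_ball t f : Bounded f -> Bounded (fball t f)
| B_bex t f : Bounded f -> Bounded (fbex t f).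

Definition Sigma01 (f : form) : Prop :=
  Bounded f \/ exists g, f = fex g /\ Bounded g.

Definition BasicAxioms (M : L2structure) : Prop :=
  (forall n : Num M, add M n (one M) <> zero M) /\
  (forall m n : Num M, add M m (one M) = add M n (one M) -> m = n) /\
  (forall m : Num M, add M m (zero M) = m) /\
  (forall m n : Num M, add M m (add M n (one M)) = add M (add M m n) (one M)) /\
  (forall m : Num M, mul M m (zero M) = zero M) /\
  (forall m n : Num M, mul M m (add M n (one M)) = add M (mul M m n) m) /\
  (forall m : Num M, ~ lt M m (zero M)) /\
  (forall m n : Num M, lt M m (add M n (one M)) <-> (lt M m n \/ m = n)).

(** Sigma^0_1 induction (variable 0 is the induction variable;
    e, E supply number and set parameters). *)
Definition Sigma01Induction (M : L2structure) : Prop :=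
  forall f, Sigma01 f ->
  forall (e : nat -> Num M) (E : nat -> SetT M),
    sat M (scons (zero M) e) E f ->
    (forall n, sat M (scons n e) E f -> sat M (scons (add M n (one M)) e) E f) ->
    forall n, sat M (scons n e) E f.

(** Delta^0_1 comprehension: phi Sigma^0_1, psi Pi^0_1 (= negation of a
    Sigma^0_1 formula g). *)
Definition Delta01Comprehension (M : L2structure) : Prop :=
  forall f g, Sigma01 f -> Sigma01 g ->
  forall (e : nat -> Num M) (E : nat -> SetT M),
    (forall n, sat M (scons n e) E f <-> ~ sat M (scons n e) E g) ->
    exists X : SetT M, forall n, mem M n X <-> sat M (scons n e) E f.

Definition RCA0model (M : L2structure) : Prop :=
  BasicAxioms M /\ Sigma01Induction M /\ Delta01Comprehension M.

Section Coding.
Variable M : L2structure.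

Definition le (x y : Num M) : Prop := lt M x y \/ x = y.

Definition pair (i j : Num M) : Num M :=
  add M (mul M (add M i j) (add M i j)) i.

Definition Infinite (X : SetT M) : Prop :=
  forall n, exists m, lt M n m /\ mem M m X.

(* F codes a coloring c : [N]^2 -> [0,a], c(x,y) = v iff ((x,y),v) \in F *)
Definition IsColoring (a : Num M) (F : SetT M) : Prop :=
  (forall x y, lt M x y -> exists v, le v a /\ mem M (pair (pair x y) v) F) /\
  (forall x y v w, lt M x y -> mem M (pair (pair x y) v) F ->
      mem M (pair (pair x y) w) F -> v = w).

Definition colval (F : SetT M) (x y v : Num M) : Prop :=
  mem M (pair (pair x y) v) F.

(* F codes a finite sequence (c_i)_{i <= a} of colorings c_i : [N]^2 -> {0,1},
   c_i(x,y) = v iff ((i,(x,y)),v) \in F *)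
Definition IsColoringSeq (a : Num M) (F : SetT M) : Prop :=
  forall i, le i a ->
  (forall x y, lt M x y -> exists v, le v (one M) /\
       mem M (pair (pair i (pair x y)) v) F) /\
  (forall x y v w, lt M x y -> mem M (pair (pair i (pair x y)) v) F ->
      mem M (pair (pair i (pair x y)) w) F -> v = w).

Definition seqval (F : SetT M) (i x y v : Num M) : Prop :=
  mem M (pair (pair i (pair x y)) v) F.

Definition TransitiveOn (c : Num M -> Num M -> Num M -> Prop) (X : SetT M) : Prop :=
  forall x y z u, mem M x X -> mem M y X -> mem M z X ->
    lt M x y -> lt M y z -> c x y u -> c y z u -> c x z u.

Definition FallowOn (c : Num M -> Num M -> Num M -> Prop) (X : SetT M) : Prop :=
  forall x y z u v w, mem M x X -> mem M y X -> mem M z X ->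
    lt M x y -> lt M y z -> c x y u -> c y z v -> c x z w -> w = u \/ w = v.

Definition EMx : Prop :=
  forall (a : Num M) (F : SetT M), IsColoringSeq a F ->
    exists X : SetT M, Infinite X /\
      forall i, le i a -> TransitiveOn (seqval F i) X.

Definition fEMfin : Prop :=
  forall (a : Num M) (F : SetT M), IsColoring a F ->
    exists X : SetT M, Infinite X /\ FallowOn (colval F) X.

End Coding.

(* Main.v *)
(* EM_x gives fEM_{<oo}: split a coloring [c] with colors [<= a] into the indicator colorings
   [c_i(x, y) = (c(x, y) == i)].  If all [c_i] are transitive on [S] and [x < y < z] in [S] had
   [c(x, z) = w] different from [c(x, y)] and [c(y, z)], then [c_w(x, y) = c_w(y, z) = 0] would
   force [c_w(x, z) = 0].

   fEM_{<oo} gives EM_x: merge [c_0, ..., c_a] into the coloring [c(x, y)] = the least number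
   whose base-[B] digits are [c_0(x, y), ..., c_a(x, y)].  Fallowness makes each digit of
   [c(x, z)] agree with that of [c(x, y)] or of [c(y, z)], which is transitivity of each [c_i].
   Without exponentiation, [B] is a power of two above [a + 1], the powers of two are the numbers
   whose only odd divisor is [1], the powers of [B] are the powers of two congruent to [1] modulo
   [B - 1], and a "ruler" number whose digit at [B^j] is [j] tells which place belongs to which
   [c_j].  Ruler and codes are built by bounded Sigma^0_1 induction, and the merged coloring is a
   bounded comprehension. *)
Require Import Defs.
From Stdlib Require Import Classical Setoid Ring.

Fixpoint ren_term (r : nat -> nat) (t : term) : term :=
  match t with
  | tvar n => tvar (r n)
  | tzero => tzero
  | tone => tone
  | tplus a b => tplus (ren_term r a) (ren_term r b)
  | ttimes a b => ttimes (ren_term r a) (ren_term r b)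
  end.

Definition up_ren (r : nat -> nat) : nat -> nat := scons O (fun n => S (r n)).

Fixpoint ren_form (r : nat -> nat) (f : form) : form :=
  match f with
  | feq a b => feq (ren_term r a) (ren_term r b)
  | flt a b => flt (ren_term r a) (ren_term r b)
  | fmem a k => fmem (ren_term r a) k
  | fnot f => fnot (ren_form r f)
  | fand f g => fand (ren_form r f) (ren_form r g)
  | f_or f g => f_or (ren_form r f) (ren_form r g)
  | fimp f g => fimp (ren_form r f) (ren_form r g)
  | fall f => fall (ren_form (up_ren r) f)
  | fex f => fex (ren_form (up_ren r) f)
  | fball t f => fball (ren_term r t) (ren_form (up_ren r) f)
  | fbex t f => fbex (ren_term r t) (ren_form (up_ren r) f)
  end.

Definition shift : term -> term := ren_term S.
Arguments shift : simpl never.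

Definition tpair (a b : term) : term := tplus (ttimes (tplus a b) (tplus a b)) a.

Definition fle (a b : term) : form := f_or (flt a b) (feq a b).

Lemma Bounded_fle a b : Bounded (fle a b).
Proof. repeat constructor. Qed.

Lemma Bounded_ren_form r f : Bounded f -> Bounded (ren_form r f).
Proof. intro H; revert r; induction H; intro r; simpl; constructor; auto. Qed.

Section Renaming.
Variable M : L2structure.

Lemma evalt_ren r (e e' : nat -> Num M) t :
  (forall n, e (r n) = e' n) -> evalt M e (ren_term r t) = evalt M e' t.
Proof. intro H; induction t; simpl; congruence. Qed.

Lemma sat_ren f : forall r (e e' : nat -> Num M) E,
  (forall n, e (r n) = e' n) -> (sat M e E (ren_form r f) <-> sat M e' E f).
Proof.
  assert (Hup : forall r (e e' : nat -> Num M) x, (forall n, e (r n) = e' n) ->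
            forall n, scons x e (up_ren r n) = scons x e' n) by (intros r e e' x H [|n]; simpl; auto).
  induction f; intros r e e' E H; simpl; repeat rewrite (evalt_ren r e e' _ H);
    try (pose proof (fun x => IHf (up_ren r) (scons x e) (scons x e') E (Hup r e e' x H)) as IH;
         setoid_rewrite IH);
    try rewrite (IHf r e e' E H); try rewrite (IHf1 r e e' E H), (IHf2 r e e' E H); reflexivity.
Qed.

Lemma evalt_shift (x : Num M) e t : evalt M (scons x e) (shift t) = evalt M e t.
Proof. apply evalt_ren; reflexivity. Qed.

End Renaming.

Section Model.
Variable M : L2structure.
Hypothesis HB : BasicAxioms M.
Hypothesis HI : Sigma01Induction M.
Hypothesis HC : Delta01Comprehension M.
(* The schemes quantify over set assignments, so even arithmetical induction needs some set:
   every formula below reads its set variables from [X0], which in the two reductions is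
   the given coloring. *)
Variable X0 : SetT M.

Local Notation N := (Num M).
Local Notation z0 := (zero M).
Local Notation o1 := (one M).
Local Notation "a +' b" := (add M a b) (at level 50, left associativity).
Local Notation "a *' b" := (mul M a b) (at level 40, left associativity).
Local Notation "a <' b" := (lt M a b) (at level 70).
Local Notation "a <=' b" := (le M a b) (at level 70).

Lemma succ_neq_zero n : n +' o1 <> z0. Proof. apply HB. Qed.
Lemma succ_inj m n : m +' o1 = n +' o1 -> m = n. Proof. apply HB. Qed.
Lemma add_0_r m : m +' z0 = m. Proof. apply HB. Qed.
Lemma add_succ_r m n : m +' (n +' o1) = (m +' n) +' o1. Proof. apply HB. Qed.
Lemma mul_0_r m : m *' z0 = z0. Proof. apply HB. Qed.
Lemma mul_succ_r m n : m *' (n +' o1) = m *' n +' m. Proof. apply HB. Qed.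
Lemma nlt_0 m : ~ m <' z0. Proof. apply HB. Qed.
Lemma lt_succ_iff m n : m <' n +' o1 <-> m <' n \/ m = n. Proof. apply HB. Qed.

Definition e0 : nat -> N := fun _ => z0.
Definition E0 : nat -> SetT M := fun _ => X0.

Lemma sigma1_ind f e (P : N -> Prop) : Sigma01 f ->
  (forall n, sat M (scons n e) E0 f <-> P n) ->
  P z0 -> (forall n, P n -> P (n +' o1)) -> forall n, P n.
Proof.
  intros Hf HP H0 HS n. apply HP, (HI f Hf e E0).
  - apply HP, H0.
  - intros m Hm. apply HP, HS, HP, Hm.
Qed.

(* [sat_db] collects the lemmas [sat_fX : sat (fX ..) <-> X ..] for the bounded formulas [fX]
   defined below, which are made Opaque so that [simpl] keeps them folded. *)
Create HintDb sat_db.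
Ltac sat_simpl := simpl; try (rewrite_strat (topdown (hints sat_db))); simpl.
Create HintDb bounded_db.
#[local] Hint Constructors Bounded : bounded_db.
#[local] Hint Resolve Bounded_fle : bounded_db.
Ltac bounded := solve [auto 100 with bounded_db].

Ltac induct f e :=
  refine (sigma1_ind f e _ _ _ _ _);
  [ try solve [left; bounded | right; eexists; split; [reflexivity | bounded]]
  | let n := fresh "n" in intro n; sat_simpl; try tauto
  | | ].

Lemma add_0_l n : z0 +' n = n.
Proof.
  revert n; induct (feq (tplus tzero (tvar 0)) (tvar 0)) e0.
  - apply add_0_r.
  - intros n H. rewrite add_succ_r, H. reflexivity.
Qed.

Lemma add_succ_l m n : (m +' o1) +' n = (m +' n) +' o1.
Proof.
  revert n.
  induct (feq (tplus (tplus (tvar 1) tone) (tvar 0)) (tplus (tplus (tvar 1) (tvar 0)) tone))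
    (scons m e0).
  - rewrite !add_0_r; reflexivity.
  - intros n H. rewrite !add_succ_r, H. reflexivity.
Qed.

Lemma add_comm m n : m +' n = n +' m.
Proof.
  revert n; induct (feq (tplus (tvar 1) (tvar 0)) (tplus (tvar 0) (tvar 1))) (scons m e0).
  - rewrite add_0_r, add_0_l; reflexivity.
  - intros n H. rewrite add_succ_r, H, add_succ_l. reflexivity.
Qed.

Lemma add_assoc m n p : m +' n +' p = m +' (n +' p).
Proof.
  revert p.
  induct (feq (tplus (tplus (tvar 1) (tvar 2)) (tvar 0)) (tplus (tvar 1) (tplus (tvar 2) (tvar 0))))
    (scons m (scons n e0)).
  - rewrite !add_0_r; reflexivity.
  - intros p H. rewrite !add_succ_r, H. reflexivity.
Qed.

Lemma mul_0_l n : z0 *' n = z0.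
Proof.
  revert n; induct (feq (ttimes tzero (tvar 0)) tzero) e0.
  - apply mul_0_r.
  - intros n H. rewrite mul_succ_r, H, add_0_r. reflexivity.
Qed.

Lemma mul_succ_l m n : (m +' o1) *' n = m *' n +' n.
Proof.
  revert n.
  induct (feq (ttimes (tplus (tvar 1) tone) (tvar 0)) (tplus (ttimes (tvar 1) (tvar 0)) (tvar 0)))
    (scons m e0).
  - rewrite !mul_0_r, add_0_r; reflexivity.
  - intros n H. rewrite !mul_succ_r, H, !add_assoc. f_equal.
    rewrite !add_succ_r, (add_comm n m). reflexivity.
Qed.

Lemma mul_comm m n : m *' n = n *' m.
Proof.
  revert n; induct (feq (ttimes (tvar 1) (tvar 0)) (ttimes (tvar 0) (tvar 1))) (scons m e0).
  - rewrite mul_0_r, mul_0_l; reflexivity.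
  - intros n H. rewrite mul_succ_r, H, mul_succ_l. reflexivity.
Qed.

Lemma mul_distr_r m n p : (m +' n) *' p = m *' p +' n *' p.
Proof.
  revert p.
  induct (feq (ttimes (tplus (tvar 1) (tvar 2)) (tvar 0))
              (tplus (ttimes (tvar 1) (tvar 0)) (ttimes (tvar 2) (tvar 0))))
    (scons m (scons n e0)).
  - rewrite !mul_0_r, add_0_r; reflexivity.
  - intros p H. rewrite !mul_succ_r, H. rewrite !add_assoc. f_equal.
    rewrite <- !add_assoc. f_equal. apply add_comm.
Qed.

Lemma mul_assoc m n p : m *' n *' p = m *' (n *' p).
Proof.
  revert p.
  induct (feq (ttimes (ttimes (tvar 1) (tvar 2)) (tvar 0))
              (ttimes (tvar 1) (ttimes (tvar 2) (tvar 0))))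
    (scons m (scons n e0)).
  - rewrite !mul_0_r; reflexivity.
  - intros p H. rewrite !mul_succ_r, H. rewrite (mul_comm m (n *' p +' n)), mul_distr_r.
    rewrite (mul_comm (n *' p) m), (mul_comm n m). reflexivity.
Qed.

Lemma mul_1_l n : o1 *' n = n.
Proof.
  rewrite <- (add_0_l o1), mul_succ_l, mul_0_l, add_0_l. reflexivity.
Qed.

Definition Nsrt : Ring_theory.semi_ring_theory z0 o1 (add M) (mul M) (@eq N).
Proof.
  constructor.
  - exact add_0_l.
  - exact add_comm.
  - intros; symmetry; apply add_assoc.
  - exact mul_1_l.
  - exact mul_0_l.
  - exact mul_comm.
  - intros; symmetry; apply mul_assoc.
  - exact mul_distr_r.
Qed.

Add Ring Nring : Nsrt.

Lemma lt_succ_diag n : n <' n +' o1.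
Proof. apply lt_succ_iff; right; reflexivity. Qed.

Lemma zero_or_succ n : n = z0 \/ exists p, n = p +' o1.
Proof.
  revert n.
  induct (f_or (feq (tvar 0) tzero) (fbex (tvar 0) (feq (tvar 1) (tplus (tvar 0) tone)))) e0.
  - split; intros [H|[x H]]; auto; right; exists x; [apply H|].
    split; [rewrite H; apply lt_succ_diag|exact H].
  - left; reflexivity.
  - intros n _; right; exists n; reflexivity.
Qed.

Lemma le_0_l n : z0 <=' n.
Proof.
  unfold le. revert n; induct (f_or (flt tzero (tvar 0)) (feq tzero (tvar 0))) e0.
  - right; reflexivity.
  - intros n [H|H]; left; apply lt_succ_iff; auto.
Qed.

Lemma lt_trans x y z : x <' y -> y <' z -> x <' z.
Proof.
  revert z.
  induct (fimp (flt (tvar 1) (tvar 2)) (fimp (flt (tvar 2) (tvar 0)) (flt (tvar 1) (tvar 0))))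
    (scons x (scons y e0)).
  - intros _ H; exfalso; eapply nlt_0; eauto.
  - intros z IH H1 H2. apply lt_succ_iff in H2. apply lt_succ_iff. destruct H2 as [H2|H2].
    + left; auto.
    + subst; left; auto.
Qed.

Lemma lt_irrefl n : ~ n <' n.
Proof.
  revert n; induct (fnot (flt (tvar 0) (tvar 0))) e0.
  - apply nlt_0.
  - intros n IH H. apply lt_succ_iff in H. destruct H as [H|H].
    + apply IH. eapply lt_trans; [apply lt_succ_diag|exact H].
    + apply IH. rewrite <- H at 2. apply lt_succ_diag.
Qed.

Lemma lt_succ_mono m n : m <' n -> m +' o1 <' n +' o1.
Proof.
  revert n.
  induct (fimp (flt (tvar 1) (tvar 0)) (flt (tplus (tvar 1) tone) (tplus (tvar 0) tone)))
    (scons m e0).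
  - intro H; exfalso; eapply nlt_0; eauto.
  - intros n IH H. apply lt_succ_iff in H. destruct H as [H|H].
    + eapply lt_trans; [apply IH; auto|apply lt_succ_diag].
    + subst; apply lt_succ_diag.
Qed.

Lemma lt_trichotomy m n : m <' n \/ m = n \/ n <' m.
Proof.
  revert n.
  induct (f_or (flt (tvar 1) (tvar 0)) (f_or (feq (tvar 1) (tvar 0)) (flt (tvar 0) (tvar 1))))
    (scons m e0).
  - destruct (le_0_l m) as [H|H]; auto.
  - intros n [H|[H|H]].
    + left; apply lt_succ_iff; auto.
    + left; apply lt_succ_iff; auto.
    + apply lt_succ_mono in H. apply lt_succ_iff in H. destruct H as [H|H]; auto.
Qed.

Lemma lt_le_succ m n : m <' n -> m +' o1 <=' n.
Proof. intro H; apply lt_succ_mono in H; apply lt_succ_iff in H; exact H. Qed.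

Lemma le_lt_succ m n : m <=' n -> m <' n +' o1.
Proof. intro H; apply lt_succ_iff; exact H. Qed.

Lemma le_refl n : n <=' n. Proof. right; reflexivity. Qed.

Lemma le_trans x y z : x <=' y -> y <=' z -> x <=' z.
Proof.
  intros [H1|H1] [H2|H2]; subst; try (right; reflexivity); left; auto. eapply lt_trans; eauto.
Qed.

Lemma lt_le_trans x y z : x <' y -> y <=' z -> x <' z.
Proof. intros H1 [H2|H2]; subst; auto. eapply lt_trans; eauto. Qed.

Lemma le_lt_trans x y z : x <=' y -> y <' z -> x <' z.
Proof. intros [H1|H1] H2; subst; auto. eapply lt_trans; eauto. Qed.

Lemma le_antisym x y : x <=' y -> y <=' x -> x = y.
Proof.
  intros [H1|H1] [H2|H2]; auto. exfalso; apply (lt_irrefl x); eapply lt_trans; eauto.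
Qed.

Lemma lt_nle x y : x <' y -> ~ y <=' x.
Proof. intros H1 H2. apply (lt_irrefl x). eapply lt_le_trans; eauto. Qed.

Lemma nlt_le x y : ~ x <' y -> y <=' x.
Proof. intro H. destruct (lt_trichotomy x y) as [H1|[H1|H1]]; [tauto|right; auto|left; auto]. Qed.

Lemma le_add n p : n <=' n +' p.
Proof.
  unfold le; revert p.
  induct (f_or (flt (tvar 1) (tplus (tvar 1) (tvar 0))) (feq (tvar 1) (tplus (tvar 1) (tvar 0))))
    (scons n e0).
  - right; rewrite add_0_r; reflexivity.
  - intros p H. left. rewrite add_succ_r. apply le_lt_succ; auto.
Qed.

Lemma le_ex_add m n : m <=' n -> exists d, n = m +' d.
Proof.
  unfold le; revert n.
  induct (fimp (f_or (flt (tvar 1) (tvar 0)) (feq (tvar 1) (tvar 0)))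
               (fbex (tplus (tvar 0) tone) (feq (tvar 1) (tplus (tvar 2) (tvar 0)))))
    (scons m e0).
  - split; intros H H1; destruct (H H1) as [d Hd]; [exists d; tauto|exists d; split; auto].
    rewrite Hd. apply le_lt_succ. rewrite add_comm. apply le_add.
  - intros [H|H]; [exfalso; eapply nlt_0; eauto|]. exists z0; rewrite add_0_r; auto.
  - intros n IH [H|H]; [apply lt_succ_iff in H; destruct H as [H|H]|].
    + destruct (IH (or_introl H)) as [d Hd]. exists (d +' o1). rewrite add_succ_r, Hd; reflexivity.
    + exists o1. subst; reflexivity.
    + exists z0. rewrite add_0_r; auto.
Qed.

Lemma lt_ex m n : m <' n <-> exists d, n = m +' d +' o1.
Proof.
  split.
  - intro H. apply lt_le_succ in H. apply le_ex_add in H. destruct H as [d Hd]. exists d. rewrite Hd. ring.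
  - intros [d Hd]. subst. apply le_lt_succ. apply le_add.
Qed.

Lemma lt_add_r m n p : m <' n -> m +' p <' n +' p.
Proof.
  intro H. apply lt_ex in H. destruct H as [d Hd]. subst. apply lt_ex. exists d. ring.
Qed.

Lemma lt_add_l m n p : m <' n -> p +' m <' p +' n.
Proof. intro H. rewrite (add_comm p m), (add_comm p n). apply lt_add_r; auto. Qed.

Lemma le_add_r m n p : m <=' n -> m +' p <=' n +' p.
Proof. intros [H|H]; [left; apply lt_add_r; auto|right; subst; auto]. Qed.

Lemma le_add_l m n p : m <=' n -> p +' m <=' p +' n.
Proof. intros [H|H]; [left; apply lt_add_l; auto|right; subst; auto]. Qed.

Lemma add_cancel_r m n p : m +' p = n +' p -> m = n.
Proof.
  intro H. destruct (lt_trichotomy m n) as [H1|[H1|H1]]; auto; exfalso.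
  - apply (lt_add_r _ _ p) in H1. rewrite H in H1. eapply lt_irrefl; eauto.
  - apply (lt_add_r _ _ p) in H1. rewrite H in H1. eapply lt_irrefl; eauto.
Qed.

Lemma add_cancel_l m n p : p +' m = p +' n -> m = n.
Proof. rewrite (add_comm p m), (add_comm p n). apply add_cancel_r. Qed.

Lemma lt_0_succ n : z0 <' n +' o1.
Proof. apply le_lt_succ, le_0_l. Qed.

Lemma pos_succ n : z0 <' n -> exists p, n = p +' o1.
Proof. intro H. destruct (zero_or_succ n) as [H1|H1]; auto. subst. exfalso; eapply lt_irrefl; eauto. Qed.

Lemma lt_mul_r m n p : m <' n -> z0 <' p -> m *' p <' n *' p.
Proof.
  intros H Hp. apply lt_ex in H. destruct H as [d ->]. apply pos_succ in Hp. destruct Hp as [q ->].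
  apply lt_ex. exists (d *' (q +' o1) +' q). ring.
Qed.

Lemma le_mul_r m n p : m <=' n -> m *' p <=' n *' p.
Proof.
  intros H. apply le_ex_add in H. destruct H as [d Hd]. subst. rewrite mul_distr_r. apply le_add.
Qed.

Lemma one_neq_zero : o1 <> z0.
Proof. intro H. apply (succ_neq_zero z0). rewrite add_0_l. exact H. Qed.

Lemma lt_0_1 : z0 <' o1.
Proof. rewrite <- (add_0_l o1). apply lt_0_succ. Qed.

Lemma nle_lt x y : ~ x <=' y -> y <' x.
Proof.
  intro H. destruct (lt_trichotomy x y) as [H1|[H1|H1]]; auto; exfalso; apply H; [left|right]; auto.
Qed.

Lemma lt_neq x y : x <' y -> x <> y.
Proof. intros H1 H2; subst; eapply lt_irrefl; eauto. Qed.

Lemma strong_ind f e (P : N -> Prop) : Bounded f ->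
  (forall n, sat M (scons n e) E0 f <-> P n) ->
  (forall n, (forall m, m <' n -> P m) -> P n) -> forall n, P n.
Proof.
  intros Hf HP Hs.
  assert (Hren : forall n m, sat M (scons m (scons n e)) E0 (ren_form (up_ren S) f) <-> P m).
  { intros n m. rewrite (sat_ren M f (up_ren S) _ (scons m e)); [apply HP | intros [|k]; reflexivity]. }
  assert (H : forall n m, m <' n -> P m).
  { refine (sigma1_ind (fball (tvar 0) (ren_form (up_ren S) f)) e _ _ _ _ _).
    - left; constructor; apply Bounded_ren_form, Hf.
    - intro n; simpl. setoid_rewrite Hren. reflexivity.
    - intros m Hm; exfalso; eapply nlt_0; eauto.
    - intros n IH m Hm. apply lt_succ_iff in Hm. destruct Hm as [Hm|Hm]; auto. subst. apply Hs; auto. }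
  intro n. apply (H (n +' o1)), lt_succ_diag.
Qed.

Lemma least_number f e (P : N -> Prop) : Bounded f ->
  (forall n, sat M (scons n e) E0 f <-> P n) ->
  (exists n, P n) -> exists n, P n /\ forall m, m <' n -> ~ P m.
Proof.
  intros Hf HP [n Hn]. apply NNPP. intro Hno.
  assert (H : forall n, ~ P n).
  { refine (strong_ind (fnot f) e _ _ _ _).
    - constructor; auto.
    - intro k; simpl. rewrite HP. reflexivity.
    - intros k Hk Pk. apply Hno. exists k. split; auto. }
  apply (H n); auto.
Qed.

Ltac sinduct f e :=
  refine (strong_ind f e _ _ _ _);
  [ try bounded
  | let n := fresh "n" in intro n; sat_simpl; try tauto
  | ].

Lemma mul_ge_l u P : z0 <' P -> u <=' u *' P.
Proof. intro H. apply pos_succ in H. destruct H as [p ->]. rewrite mul_succ_r, add_comm. apply le_add. Qed.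

Lemma sq_lt S1 S2 i k : S1 <' S2 -> i <=' S1 -> S1 *' S1 +' i <' S2 *' S2 +' k.
Proof.
  intros H Hi. apply lt_le_succ in H.
  apply (le_lt_trans _ (S1 *' S1 +' S1)); [apply le_add_l; auto|].
  apply (lt_le_trans _ ((S1 +' o1) *' (S1 +' o1))).
  - apply lt_ex. exists S1. ring.
  - eapply le_trans; [|apply le_add]. eapply le_trans; [apply le_mul_r; exact H|].
    rewrite (mul_comm S2 (S1 +' o1)). apply le_mul_r; auto.
Qed.

Lemma pair_inj i j k l : pair M i j = pair M k l -> i = k /\ j = l.
Proof.
  unfold pair. intro H.
  destruct (lt_trichotomy (i +' j) (k +' l)) as [H1|[H1|H1]].
  - exfalso. apply (lt_neq _ _ (sq_lt _ _ i k H1 (le_add i j))); auto.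
  - rewrite H1 in H. apply add_cancel_l in H. subst. split; auto. eapply add_cancel_l; eauto.
  - exfalso. apply (lt_neq _ _ (sq_lt _ _ k i H1 (le_add k l))); auto.
Qed.

Lemma pair_ge_l i j : i <=' pair M i j.
Proof. unfold pair. rewrite add_comm. apply le_add. Qed.

Lemma pair_ge_r i j : j <=' pair M i j.
Proof.
  unfold pair. apply (le_trans _ (i +' j)); [rewrite add_comm; apply le_add|].
  destruct (le_0_l (i +' j)) as [H|H].
  - eapply le_trans; [apply (mul_ge_l _ _ H)|apply le_add].
  - rewrite <- H. apply le_0_l.
Qed.

Lemma triple_comprehension f e (R : N -> N -> N -> Prop) : Bounded f ->
  (forall x y v, sat M (scons v (scons y (scons x e))) E0 f <-> R x y v) ->
  exists X, forall x y v, mem M (pair M (pair M x y) v) X <-> R x y v.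
Proof.
  intros Hf HR.
  set (r := fun i => match i with 0 | 1 | 2 => i | S j => S (S j) end).
  assert (Hren : forall n x y v,
            sat M (scons v (scons y (scons x (scons n e)))) E0 (ren_form r f) <-> R x y v).
  { intros n x y v. rewrite (sat_ren M f r _ (scons v (scons y (scons x e)))); [apply HR|].
    intros [|[|[|k]]]; reflexivity. }
  set (g := fbex (tplus (tvar 0) tone) (fbex (tplus (tvar 1) tone) (fbex (tplus (tvar 2) tone)
              (fand (feq (tvar 3) (tpair (tpair (tvar 2) (tvar 1)) (tvar 0))) (ren_form r f))))).
  assert (Hg : Bounded g) by (repeat constructor; apply Bounded_ren_form, Hf).
  destruct (HC g (fnot g) (or_introl Hg) (or_introl (B_not _ Hg)) e E0) as [X HX].
  { intro n; simpl (sat _ _ _ (fnot _)). split; [tauto | apply NNPP]. }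
  exists X. intros x y v. rewrite HX. unfold g; simpl. setoid_rewrite Hren. split.
  - intros [x' [_ [y' [_ [v' [_ [E H]]]]]]].
    destruct (pair_inj _ _ _ _ E) as [E1 E2]. destruct (pair_inj _ _ _ _ E1) as [E3 E4].
    subst. exact H.
  - intro H. assert (Hxy := pair_ge_l (pair M x y) v).
    exists x. split; [apply le_lt_succ; eapply le_trans; [apply pair_ge_l|exact Hxy]|].
    exists y. split; [apply le_lt_succ; eapply le_trans; [apply pair_ge_r|exact Hxy]|].
    exists v. split; [apply le_lt_succ, pair_ge_r|]. split; [reflexivity|exact H].
Qed.

(* Sigma^0_1 formulas have a single unbounded existential, so both witnesses are bounded by one
   [m]; the disjunct [a < n] keeps the statement inductive beyond [a]. *)
Lemma sigma1_ind2_upto f e a (P : N -> N -> N -> Prop) : Bounded f ->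
  (forall n x y, sat M (scons y (scons x (scons n (scons a e)))) E0 f <-> P n x y) ->
  (exists x y, P z0 x y) ->
  (forall k, k <' a -> (exists x y, P k x y) -> exists x y, P (k +' o1) x y) ->
  exists x y, P a x y.
Proof.
  intros Hf HP H0 HS.
  set (r := fun i => match i with 0 | 1 => i | S j => S (S j) end).
  assert (Hren : forall n m x y,
            sat M (scons y (scons x (scons m (scons n (scons a e))))) E0 (ren_form r f) <-> P n x y).
  { intros n m x y. rewrite (sat_ren M f r _ (scons y (scons x (scons n (scons a e))))); [apply HP|].
    intros [|[|k]]; reflexivity. }
  assert (Hbound : forall n x y, P n x y ->
            exists m, a <' n \/ exists x, x <' m /\ exists y, y <' m /\ P n x y).
  { intros n x y Hxy. exists (x +' y +' o1). right.
    exists x. split; [apply le_lt_succ, le_add|].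
    exists y. split; [apply le_lt_succ; rewrite add_comm; apply le_add | exact Hxy]. }
  assert (H : forall n, exists m, a <' n \/ exists x, x <' m /\ exists y, y <' m /\ P n x y).
  { refine (sigma1_ind (fex (f_or (flt (tvar 2) (tvar 1))
              (fbex (tvar 0) (fbex (tvar 1) (ren_form r f))))) (scons a e) _ _ _ _ _).
    - right; eexists; split; [reflexivity|]. repeat constructor. apply Bounded_ren_form, Hf.
    - intro n; simpl. setoid_rewrite Hren. reflexivity.
    - destruct H0 as [x [y Hxy]]. eapply Hbound, Hxy.
    - intros n [m Hm]. destruct (classic (a <' n +' o1)) as [Ha|Ha]; [exists m; left; exact Ha|].
      apply nlt_le in Ha. assert (Hn : n <' a) by (eapply lt_le_trans; [apply lt_succ_diag|exact Ha]).
      destruct Hm as [Hm|[x [_ [y [_ Hxy]]]]]; [exfalso; eapply lt_irrefl, lt_trans; eauto|].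
      destruct (HS n Hn (ex_intro _ x (ex_intro _ y Hxy))) as [x' [y' Hxy']].
      eapply Hbound, Hxy'. }
  destruct (H a) as [m [Ha|[x [_ [y [_ Hxy]]]]]]; [exfalso; eapply lt_irrefl; eauto | eauto].
Qed.

Definition even x := exists h, x = h +' h.
Definition odd x := exists h, x = h +' h +' o1.

Lemma even_or_odd n : even n \/ odd n.
Proof.
  assert (H : forall n, exists h, h <' n +' o1 /\ (n = h +' h \/ n = h +' h +' o1)).
  { induct (fbex (tplus (tvar 0) tone) (f_or (feq (tvar 1) (tplus (tvar 0) (tvar 0)))
                                             (feq (tvar 1) (tplus (tplus (tvar 0) (tvar 0)) tone)))) e0.
    - exists z0. split; [apply lt_0_succ|left; rewrite add_0_r; reflexivity].
    - intros k [h [Hh [H|H]]].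
      + exists h. split; [eapply lt_trans; [exact Hh|apply lt_succ_diag]|right; rewrite H; reflexivity].
      + exists (h +' o1). split; [apply lt_succ_mono; auto|left; rewrite H; ring]. }
  destruct (H n) as [h [_ [Hh|Hh]]]; [left|right]; exists h; auto.
Qed.

Lemma even_odd_exclusive n : even n -> odd n -> False.
Proof.
  intros [h Hh] [k Hk]. subst. destruct (classic (h <=' k)) as [H1|H1].
  - apply le_ex_add in H1. destruct H1 as [d Hd]. subst.
    apply (lt_neq (h +' h) ((h +' d) +' (h +' d) +' o1)); auto.
    apply lt_ex. exists (d +' d). ring.
  - apply nle_lt, lt_ex in H1. destruct H1 as [d Hd]. subst.
    apply (lt_neq (k +' k +' o1) ((k +' d +' o1) +' (k +' d +' o1))); auto.
    apply lt_ex. exists (d +' d). ring.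
Qed.

Lemma odd_mul a b : odd a -> odd b -> odd (a *' b).
Proof. intros [h Hh] [k Hk]; subst. exists (h *' k +' h *' k +' h +' k). ring. Qed.

Lemma double_lt_mono h k : h <' k -> h +' h <' k +' k.
Proof. intro H. eapply lt_trans; [apply lt_add_r; eauto|apply lt_add_l; eauto]. Qed.

Lemma double_inj h k : h +' h = k +' k -> h = k.
Proof.
  intro H. destruct (lt_trichotomy h k) as [H1|[H1|H1]]; auto; exfalso;
    apply double_lt_mono in H1; rewrite H in H1; eapply lt_irrefl; eauto.
Qed.

Lemma lt_double Q : z0 <' Q -> Q <' Q +' Q.
Proof. intro H. apply pos_succ in H. destruct H as [q Hq]. subst. apply lt_ex. exists q. ring. Qed.

Lemma factor_le_l d m P : d *' m = P -> P <> z0 -> d <=' P.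
Proof.
  intros H HP. destruct (zero_or_succ m) as [Hm|[m' Hm]]; subst.
  - exfalso; apply HP; rewrite mul_0_r; auto.
  - rewrite mul_succ_r, add_comm. apply le_add.
Qed.

Lemma factor_le_r d m P : d *' m = P -> P <> z0 -> m <=' P.
Proof. intros H HP. rewrite mul_comm in H. eapply factor_le_l; eauto. Qed.

Definition Pow2 P := P <> z0 /\ forall d m, d *' m = P -> d = o1 \/ even d.

Definition fPow2 (p : term) : form :=
  fand (fnot (feq p tzero)) (fball (tplus p tone) (fball (tplus (shift p) tone)
    (fimp (feq (ttimes (tvar 1) (tvar 0)) (shift (shift p)))
      (f_or (feq (tvar 1) tone) (fbex (tplus (tvar 1) tone) (feq (tvar 2) (tplus (tvar 0) (tvar 0)))))))).

Lemma Bounded_fPow2 p : Bounded (fPow2 p).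
Proof. unfold fPow2; bounded. Qed.

Lemma sat_fPow2 e E p : sat M e E (fPow2 p) <-> Pow2 (evalt M e p).
Proof.
  unfold fPow2, Pow2; simpl. repeat setoid_rewrite evalt_shift. split.
  - intros [H1 H2]. split; auto. intros d m Hdm.
    destruct (H2 d (le_lt_succ _ _ (factor_le_l _ _ _ Hdm H1)) m
                   (le_lt_succ _ _ (factor_le_r _ _ _ Hdm H1)) Hdm) as [H|[h [_ H]]]; auto.
    right; exists h; auto.
  - intros [H1 H2]. split; auto. intros d _ m _ Hdm. destruct (H2 d m Hdm) as [H|[h H]]; auto.
    right; exists h; split; auto. apply le_lt_succ. rewrite H. apply le_add.
Qed.

Opaque fPow2.
#[local] Hint Resolve Bounded_fPow2 : bounded_db.
#[local] Hint Rewrite sat_fPow2 : sat_db.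

Lemma Pow2_pos P : Pow2 P -> z0 <' P.
Proof. intros [H _]. destruct (le_0_l P) as [H1|H1]; auto. subst; tauto. Qed.

Lemma Pow2_1 : Pow2 o1.
Proof.
  split; [apply one_neq_zero|]. intros d m H. left. apply le_antisym.
  - eapply factor_le_l; eauto. apply one_neq_zero.
  - destruct (le_0_l d) as [H1|H1]; [apply lt_le_succ in H1; rewrite add_0_l in H1; auto|].
    subst. rewrite mul_0_l in H. exfalso; apply one_neq_zero; auto.
Qed.

Lemma Pow2_double P : Pow2 P -> Pow2 (P +' P).
Proof.
  intros [H1 H2]. split.
  - intro H. apply H1. apply le_antisym; [|apply le_0_l]. rewrite <- H. apply le_add.
  - intros d m H. destruct (even_or_odd d) as [Hd|Hd]; auto.
    destruct (even_or_odd m) as [[m' Hm]|Hm].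
    + subst. apply (H2 d m'), double_inj. rewrite <- H. ring.
    + exfalso. apply (even_odd_exclusive (d *' m)); [exists P; auto|apply odd_mul; auto].
Qed.

Lemma Pow2_half P : Pow2 P -> P <> o1 -> exists Q, P = Q +' Q /\ Pow2 Q.
Proof.
  intros [H1 H2] Hne. destruct (H2 P o1) as [H|[Q HQ]]; [ring| tauto |].
  exists Q. split; auto. split.
  - intro H; subst. apply H1. ring.
  - intros d m H. apply (H2 d (m +' m)). rewrite HQ, <- H. ring.
Qed.

Lemma Pow2_double_gt1 P : Pow2 P -> o1 <' P +' P.
Proof.
  intro H. apply Pow2_pos in H. apply (le_lt_trans _ P); [|apply lt_double, H].
  apply lt_le_succ in H. rewrite add_0_l in H. exact H.
Qed.

Lemma Pow2_mul P Q : Pow2 P -> Pow2 Q -> Pow2 (P *' Q).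
Proof.
  intro HP. revert Q.
  sinduct (fimp (fPow2 (tvar 0)) (fPow2 (ttimes (tvar 1) (tvar 0)))) (scons P e0).
  intros Q IH HQ. destruct (classic (Q = o1)) as [->|E].
  - rewrite mul_comm, mul_1_l. exact HP.
  - destruct (Pow2_half Q HQ E) as [Q' [-> HQ']].
    replace (P *' (Q' +' Q')) with (P *' Q' +' P *' Q') by ring.
    apply Pow2_double, IH, HQ'. apply lt_double, Pow2_pos, HQ'.
Qed.

Lemma Pow2_div P R : Pow2 P -> Pow2 R -> P <=' R -> exists Q, R = P *' Q /\ Pow2 Q.
Proof.
  (* Halve both sides until the divisor is [1]; the induction on the divisor carries all [R' <= R]. *)
  assert (H : forall A R', R' <=' R -> Pow2 A -> Pow2 R' -> A <=' R' ->
            exists Q, Q <=' R' /\ R' = A *' Q /\ Pow2 Q).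
  { sinduct (fball (tplus (tvar 1) tone) (fimp (fPow2 (tvar 1)) (fimp (fPow2 (tvar 0))
      (fimp (fle (tvar 1) (tvar 0)) (fbex (tplus (tvar 0) tone)
        (fand (feq (tvar 1) (ttimes (tvar 2) (tvar 0))) (fPow2 (tvar 0)))))))) (scons R e0).
    - setoid_rewrite lt_succ_iff. reflexivity.
    - intros A IH R' HR' HA HR HAR. destruct (classic (A = o1)) as [->|E].
      { exists R'. split; [apply le_refl|]. rewrite mul_1_l. auto. }
      destruct (Pow2_half A HA E) as [A' [-> HA']].
      assert (ER : R' <> o1) by (intros ->; apply (lt_nle _ _ (Pow2_double_gt1 _ HA')), HAR).
      destruct (Pow2_half R' HR ER) as [R'' [-> HR'']].
      assert (HAR' : A' <=' R'')
        by (apply nlt_le; intro H; apply (lt_nle _ _ (double_lt_mono _ _ H)), HAR).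
      destruct (IH A' (lt_double _ (Pow2_pos _ HA')) R'' (le_trans _ _ _ (le_add _ _) HR') HA' HR'' HAR')
        as [Q [HQ [-> HQp]]].
      exists Q. split; [eapply le_trans; [exact HQ|apply le_add]|]. split; [ring|exact HQp]. }
  intros HP HR HPR. destruct (H P R (le_refl R) HP HR HPR) as [Q [_ HQ]]. exists Q; exact HQ.
Qed.

Lemma Pow2_exists n : exists P, Pow2 P /\ n <' P.
Proof.
  revert n. induct (fex (fand (fPow2 (tvar 0)) (flt (tvar 1) (tvar 0)))) e0.
  - exists o1. split; [apply Pow2_1|apply lt_0_1].
  - intros n [P [HP Hn]]. exists (P +' P). split; [apply Pow2_double; auto|].
    apply (le_lt_trans _ P); [apply lt_le_succ; auto|apply lt_double, Pow2_pos, HP].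
Qed.
Lemma div_ex P q : z0 <' P -> exists u r, q = u *' P +' r /\ r <' P.
Proof.
  intro HP. assert (H : exists u, u <' q +' o1 /\ exists r, r <' P /\ q = u *' P +' r).
  { revert q. induct (fbex (tplus (tvar 0) tone)
      (fbex (tvar 2) (feq (tvar 2) (tplus (ttimes (tvar 1) (tvar 3)) (tvar 0))))) (scons P e0).
    - exists z0. split; [apply lt_0_succ|]. exists z0. split; auto. rewrite mul_0_l, add_0_r; auto.
    - intros q [u [Hu [r [Hr Hq]]]]. apply lt_le_succ in Hr. destruct Hr as [Hr|Hr].
      + exists u. split; [eapply lt_trans; [exact Hu|apply lt_succ_diag]|].
        exists (r +' o1). split; auto. rewrite Hq; ring.
      + exists (u +' o1). split; [apply lt_succ_mono; auto|].
        exists z0. split; auto. rewrite Hq, <- Hr. ring. }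
  destruct H as [u [_ [r [Hr Hq]]]]. exists u, r; auto.
Qed.

Lemma divmod_lt P u r u' r' : u <' u' -> r <' P -> u *' P +' r <' u' *' P +' r'.
Proof.
  intros Hu Hr. apply lt_ex in Hu. destruct Hu as [d ->].
  apply (lt_le_trans _ (u *' P +' P)); [apply lt_add_l; auto|].
  replace ((u +' d +' o1) *' P +' r') with (u *' P +' P +' (d *' P +' r')) by ring. apply le_add.
Qed.

Lemma div_unique P u r u' r' : u *' P +' r = u' *' P +' r' -> r <' P -> r' <' P -> u = u' /\ r = r'.
Proof.
  intros H Hr Hr'.
  assert (Hu : u = u').
  { destruct (lt_trichotomy u u') as [H1|[H1|H1]]; auto; exfalso.
    - exact (lt_neq _ _ (divmod_lt P u r u' r' H1 Hr) H).
    - exact (lt_neq _ _ (divmod_lt P u' r' u r H1 Hr') (eq_sym H)). }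
  subst. split; auto. eapply add_cancel_l; eauto.
Qed.

Definition Digit (B q P t : N) := exists u r w, q = u *' P +' r /\ r <' P /\ u = w *' B +' t /\ t <' B.

Lemma Digit_unique B q P t t' : Digit B q P t -> Digit B q P t' -> t = t'.
Proof.
  intros [u [r [w [H1 [H2 [H3 H4]]]]]] [u' [r' [w' [H1' [H2' [H3' H4']]]]]].
  rewrite H1 in H1'. destruct (div_unique _ _ _ _ _ H1' H2 H2') as [E1 _]. rewrite E1, H3' in H3.
  destruct (div_unique _ _ _ _ _ H3 H4' H4) as [_ E2]. auto.
Qed.

Lemma Digit_exists B q P : z0 <' P -> z0 <' B -> exists t, Digit B q P t.
Proof.
  intros HP HB'. destruct (div_ex P q HP) as [u [r [H1 H2]]]. destruct (div_ex B u HB') as [w [t [H3 H4]]].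
  exists t, u, r, w. auto.
Qed.

Lemma Digit_le B q P t : Digit B q P t -> t <=' q.
Proof.
  intros [u [r [w [H1 [H2 [H3 H4]]]]]]. subst.
  assert (HB' : z0 <' B) by (eapply le_lt_trans; [apply le_0_l|exact H4]).
  assert (HP : z0 <' P) by (eapply le_lt_trans; [apply le_0_l|exact H2]).
  eapply le_trans; [|apply le_add]. eapply le_trans; [|apply mul_ge_l; auto].
  rewrite add_comm. apply le_add.
Qed.

Lemma Digit_add_mul B q P t d m : Digit B q P t -> Digit B (q +' d *' (P *' B *' m)) P t.
Proof.
  intros [u [r [w [H1 [H2 [H3 H4]]]]]]. exists (u +' d *' B *' m), r, (w +' d *' m).
  subst. split; [ring|split; auto]. split; [ring|auto].
Qed.

Lemma Digit_add_top B q R d : q <' R -> d <' B -> Digit B (q +' d *' R) R d.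
Proof.
  intros H1 H2. exists d, q, z0. split; [ring|split; auto]. split; [ring|auto].
Qed.

Definition fDigit (b q p t : term) : form :=
  fbex (tplus q tone) (fbex (shift p) (fbex (tplus (shift (shift q)) tone)
   (fand (feq (shift (shift (shift q))) (tplus (ttimes (tvar 2) (shift (shift (shift p)))) (tvar 1)))
   (fand (feq (tvar 2) (tplus (ttimes (tvar 0) (shift (shift (shift b)))) (shift (shift (shift t)))))
         (flt (shift (shift (shift t))) (shift (shift (shift b)))))))).

Lemma Bounded_fDigit b q p t : Bounded (fDigit b q p t).
Proof. unfold fDigit; bounded. Qed.

Lemma sat_fDigit e E b q p t :
  sat M e E (fDigit b q p t) <-> Digit (evalt M e b) (evalt M e q) (evalt M e p) (evalt M e t).
Proof.
  unfold fDigit, Digit; simpl. repeat setoid_rewrite evalt_shift. split.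
  - intros [u [_ [r [Hr [w [_ H]]]]]]. exists u, r, w. tauto.
  - intros [u [r [w [H1 [H2 [H3 H4]]]]]].
    assert (HB' : z0 <' evalt M e b) by (eapply le_lt_trans; [apply le_0_l|exact H4]).
    assert (HP : z0 <' evalt M e p) by (eapply le_lt_trans; [apply le_0_l|exact H2]).
    assert (Hu : u <=' evalt M e q) by (rewrite H1; eapply le_trans; [apply mul_ge_l; eauto|apply le_add]).
    exists u. split; [apply le_lt_succ; auto|]. exists r. split; auto. exists w. split; [|tauto].
    apply le_lt_succ. eapply le_trans; [|exact Hu]. rewrite H3.
    eapply le_trans; [apply (mul_ge_l w _ HB')|apply le_add].
Qed.

Opaque fDigit.
#[local] Hint Resolve Bounded_fDigit : bounded_db.
#[local] Hint Rewrite sat_fDigit : sat_db.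

(* For a power of two [B = B' + 1 = 2^m], a power of two is a power of [B] iff it is [1]
   modulo [B'], since [2^n = 1 (mod 2^m - 1)] iff [m] divides [n]. *)
Definition PowB (B' P : N) := Pow2 P /\ exists t, t <=' P /\ P = t *' B' +' o1.

Definition fPowB (b' p : term) : form :=
  fand (fPow2 p) (fbex (tplus p tone) (feq (shift p) (tplus (ttimes (tvar 0) (shift b')) tone))).

Lemma Bounded_fPowB b' p : Bounded (fPowB b' p).
Proof. unfold fPowB; bounded. Qed.

Lemma sat_fPowB e E b' p : sat M e E (fPowB b' p) <-> PowB (evalt M e b') (evalt M e p).
Proof.
  unfold fPowB, PowB; sat_simpl. repeat setoid_rewrite evalt_shift.
  setoid_rewrite lt_succ_iff. reflexivity.
Qed.

Opaque fPowB.
#[local] Hint Resolve Bounded_fPowB : bounded_db.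
#[local] Hint Rewrite sat_fPowB : sat_db.

Lemma all_Digit_bounded b q P (Q : N -> Prop) :
  (forall t, t <' q +' o1 -> Digit b q P t -> Q t) <-> (forall t, Digit b q P t -> Q t).
Proof.
  split; intros H t Ht; [apply H; [apply le_lt_succ; eapply Digit_le; eauto|]|apply H]; auto.
Qed.

Lemma ex_Digit_bounded b q P (Q : N -> Prop) :
  (exists t, t <' q +' o1 /\ Digit b q P t /\ Q t) <-> (exists t, Digit b q P t /\ Q t).
Proof.
  split; intros [t Ht]; exists t; [tauto|].
  split; [apply le_lt_succ; apply (Digit_le b q P t)|]; tauto.
Qed.

(* [s] numbers the places [1, B, ..., B^k = Pl] of base-[B] expansions: its digit at [B^j] is [j]. *)
Definition Ruler (B B' s Pl k : N) :=
  PowB B' Pl /\ s <' Pl *' B /\ Digit B s Pl k /\ Digit B s o1 z0 /\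
  (forall P, P <' Pl -> PowB B' P -> forall t, Digit B s P t -> Digit B s (P *' B) (t +' o1)) /\
  (forall P, P <=' Pl -> PowB B' P -> forall t, Digit B s P t -> t <=' k /\ (t = k -> P = Pl)).

Definition fRuler (b b' s pl k : term) : form :=
  let sh2 t := shift (shift t) in
  let at_places_with_digit g := fimp (fPowB (shift b') (tvar 0))
    (fball (tplus (shift s) tone) (fimp (fDigit (sh2 b) (sh2 s) (tvar 1) (tvar 0)) g)) in
  fand (fPowB b' pl) (fand (flt s (ttimes pl b)) (fand (fDigit b s pl k) (fand (fDigit b s tone tzero)
  (fand (fball pl (at_places_with_digit
           (fDigit (sh2 b) (sh2 s) (ttimes (tvar 1) (sh2 b)) (tplus (tvar 0) tone))))
        (fball (tplus pl tone) (at_places_with_digit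
           (fand (fle (tvar 0) (sh2 k)) (fimp (feq (tvar 0) (sh2 k)) (feq (tvar 1) (sh2 pl)))))))))).

Lemma Bounded_fRuler b b' s pl k : Bounded (fRuler b b' s pl k).
Proof. unfold fRuler; bounded. Qed.

Lemma sat_fRuler e E b b' s pl k : sat M e E (fRuler b b' s pl k) <->
  Ruler (evalt M e b) (evalt M e b') (evalt M e s) (evalt M e pl) (evalt M e k).
Proof.
  unfold fRuler, Ruler; sat_simpl. repeat setoid_rewrite evalt_shift.
  setoid_rewrite all_Digit_bounded. setoid_rewrite lt_succ_iff. reflexivity.
Qed.

Opaque fRuler.
#[local] Hint Resolve Bounded_fRuler : bounded_db.
#[local] Hint Rewrite sat_fRuler : sat_db.

Definition Bit (B s q P x y : N) :=
  exists t, Digit B q P t /\ exists j, Digit B s P j /\ seqval M X0 j x y t.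

Definition fBit (b s q p x y : term) : form :=
  let sh2 t := shift (shift t) in
  fbex (tplus q tone) (fand (fDigit (shift b) (shift q) (shift p) (tvar 0))
    (fbex (tplus (shift s) tone) (fand (fDigit (sh2 b) (sh2 s) (sh2 p) (tvar 0))
      (fmem (tpair (tpair (tvar 0) (tpair (sh2 x) (sh2 y))) (tvar 1)) 0)))).

Lemma Bounded_fBit b s q p x y : Bounded (fBit b s q p x y).
Proof. unfold fBit; bounded. Qed.

Lemma sat_fBit e b s q p x y : sat M e E0 (fBit b s q p x y) <->
  Bit (evalt M e b) (evalt M e s) (evalt M e q) (evalt M e p) (evalt M e x) (evalt M e y).
Proof.
  unfold fBit, Bit; sat_simpl. repeat setoid_rewrite evalt_shift.
  repeat setoid_rewrite ex_Digit_bounded. reflexivity.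
Qed.

Opaque fBit.
#[local] Hint Resolve Bounded_fBit : bounded_db.
#[local] Hint Rewrite sat_fBit : sat_db.

Definition Code (B B' s Pl q x y : N) :=
  q <' Pl *' B /\ forall P, P <=' Pl -> PowB B' P -> Bit B s q P x y.

Definition fCode (b b' s pl q x y : term) : form :=
  fand (flt q (ttimes pl b)) (fball (tplus pl tone) (fimp (fPowB (shift b') (tvar 0))
    (fBit (shift b) (shift s) (shift q) (tvar 0) (shift x) (shift y)))).

Lemma Bounded_fCode b b' s pl q x y : Bounded (fCode b b' s pl q x y).
Proof. unfold fCode; bounded. Qed.

Lemma sat_fCode e b b' s pl q x y : sat M e E0 (fCode b b' s pl q x y) <->
  Code (evalt M e b) (evalt M e b') (evalt M e s) (evalt M e pl) (evalt M e q) (evalt M e x) (evalt M e y).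
Proof.
  unfold fCode, Code; sat_simpl. repeat setoid_rewrite evalt_shift.
  setoid_rewrite lt_succ_iff. reflexivity.
Qed.

Opaque fCode.
#[local] Hint Resolve Bounded_fCode : bounded_db.
#[local] Hint Rewrite sat_fCode : sat_db.

Section PowersOfB.
Variables B B' : N.
Hypothesis HB' : B = B' +' o1.
Hypothesis Pow2_B : Pow2 B.
Hypothesis B'_pos : z0 <' B'.

Lemma B_gt1 : o1 <' B.
Proof. rewrite HB'. destruct (pos_succ _ B'_pos) as [p Hp]. rewrite Hp. apply lt_ex. exists p. ring. Qed.

Lemma B_pos : z0 <' B.
Proof. eapply lt_trans; [apply lt_0_1|apply B_gt1]. Qed.

Lemma lt_mul_B P : z0 <' P -> P <' P *' B.
Proof.
  intro H. apply (lt_le_trans _ (P *' (o1 +' o1))).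
  - replace (P *' (o1 +' o1)) with (P +' P) by ring. apply lt_double; auto.
  - rewrite (mul_comm P), (mul_comm P). apply le_mul_r, lt_le_succ, B_gt1.
Qed.

Lemma PowB_1 : PowB B' o1.
Proof. split; [apply Pow2_1|]. exists z0. split; [apply le_0_l|]. ring. Qed.

Lemma PowB_pos P : PowB B' P -> z0 <' P.
Proof. intros [H _]. apply Pow2_pos; auto. Qed.

Lemma PowB_ge1 P : PowB B' P -> o1 <=' P.
Proof. intro H. apply PowB_pos, lt_le_succ in H. rewrite add_0_l in H. exact H. Qed.

Lemma PowB_mul_B P : PowB B' P -> PowB B' (P *' B).
Proof.
  intros [HP [t [Ht HPt]]]. split; [apply Pow2_mul; auto|].
  exists (t *' B +' o1). split; [|rewrite HB', HPt; ring].
  assert (H1 : t <' P).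
  { rewrite HPt. apply (lt_le_trans _ (t +' o1)); [apply lt_succ_diag|].
    apply le_add_r, mul_ge_l; auto. }
  apply lt_le_succ in H1. apply (le_mul_r _ _ B) in H1. eapply le_trans; [|exact H1].
  rewrite mul_distr_r, mul_1_l. apply le_add_l.
  pose proof B_pos as HBp. apply lt_le_succ in HBp. rewrite add_0_l in HBp. exact HBp.
Qed.

(* [R = P * Q] with [Q] a power of two; as [P] and [R] are [1] modulo [B'], so is [Q], and
   [Q > 1] then gives [Q >= B], so that [B] divides [Q]. *)
Lemma PowB_dvd P R : PowB B' P -> PowB B' R -> P <' R -> exists m, R = P *' B *' m.
Proof.
  intros [HP [t [_ Ht]]] [HR [u [_ Hu]]] HPR.
  destruct (Pow2_div P R HP HR (or_introl HPR)) as [Q [HQ HQp]].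
  destruct (pos_succ _ (Pow2_pos _ HQp)) as [Q' HQ'].
  assert (E1 : u *' B' = t *' B' *' Q +' Q').
  { apply succ_inj. rewrite <- Hu, HQ, Ht, HQ'. ring. }
  assert (E2 : t *' Q <=' u).
  { apply nlt_le. intro H. apply (lt_mul_r _ _ B') in H; auto.
    apply (lt_nle _ _ H). rewrite E1. replace (t *' B' *' Q) with (t *' Q *' B') by ring. apply le_add. }
  apply le_ex_add in E2. destruct E2 as [w Hw].
  assert (E3 : Q' = w *' B').
  { apply (add_cancel_l _ _ (t *' B' *' Q)). rewrite <- E1, Hw. ring. }
  assert (Hw0 : z0 <' w).
  { destruct (le_0_l w) as [H|H]; auto. exfalso. subst w. rewrite mul_0_l in E3. subst Q'.
    rewrite add_0_l in HQ'. subst Q. rewrite mul_comm, mul_1_l in HQ. rewrite HQ in HPR.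
    eapply lt_irrefl; eauto. }
  assert (HBQ : B <=' Q).
  { rewrite HQ', E3, HB'. apply le_add_r. rewrite mul_comm. apply mul_ge_l; auto. }
  destruct (Pow2_div B Q Pow2_B HQp HBQ) as [m [Hm _]].
  exists m. rewrite HQ, Hm. ring.
Qed.

Lemma PowB_mul_B_le P R : PowB B' P -> PowB B' R -> P <' R -> P *' B <=' R.
Proof.
  intros HP HR HPR. destruct (PowB_dvd P R HP HR HPR) as [m Hm].
  rewrite Hm. apply mul_ge_l. destruct (le_0_l m) as [H|H]; auto. rewrite <- H in Hm.
  exfalso. apply (lt_irrefl z0). rewrite mul_0_r in Hm. rewrite <- Hm at 2. apply (PowB_pos R HR).
Qed.

Lemma PowB_le_of_lt_mul_B P Q : PowB B' P -> PowB B' Q -> P <' Q *' B -> P <=' Q.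
Proof. intros HP HQ H. apply nlt_le. intro H1. apply (lt_nle _ _ H). apply PowB_mul_B_le; auto. Qed.

Lemma Digit_add_higher q P R d t : PowB B' P -> PowB B' R -> P <' R ->
  Digit B q P t -> Digit B (q +' d *' R) P t.
Proof. intros HP HR HPR H. destruct (PowB_dvd P R HP HR HPR) as [m ->]. apply Digit_add_mul; auto. Qed.

Lemma Digit_add_higher_inv q P R d t : PowB B' P -> PowB B' R -> P <' R ->
  Digit B (q +' d *' R) P t -> Digit B q P t.
Proof.
  intros HP HR HPR H. destruct (Digit_exists B q P (PowB_pos P HP) B_pos) as [t0 Ht0].
  rewrite (Digit_unique _ _ _ _ _ H (Digit_add_higher q P R d t0 HP HR HPR Ht0)). exact Ht0.
Qed.

Lemma Digit_1 v : v <' B -> Digit B v o1 v.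
Proof.
  intro H. assert (H1 := Digit_add_top B z0 o1 v lt_0_1 H).
  rewrite add_0_l, mul_comm, mul_1_l in H1. exact H1.
Qed.

Lemma add_top_lt q R d : q <' R -> d <' B -> q +' d *' R <' R *' B.
Proof.
  intros H1 H2. apply (lt_le_trans _ (R +' d *' R)); [apply lt_add_r; auto|].
  replace (R +' d *' R) with ((d +' o1) *' R) by ring. rewrite (mul_comm R B).
  apply le_mul_r, lt_le_succ, H2.
Qed.

Lemma Ruler_0 : Ruler B B' z0 o1 z0.
Proof.
  assert (D0 : Digit B z0 o1 z0) by apply Digit_1, B_pos.
  split; [apply PowB_1|]. split; [rewrite mul_1_l; apply B_pos|].
  split; [exact D0|]. split; [exact D0|]. split.
  - intros P HP HPB. exfalso. apply (lt_nle _ _ HP), PowB_ge1, HPB.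
  - intros P HP HPB t Ht.
    assert (P = o1) by (apply le_antisym; [exact HP | apply PowB_ge1, HPB]). subst P.
    rewrite (Digit_unique _ _ _ _ _ Ht D0). split; [apply le_refl | reflexivity].
Qed.

Lemma Ruler_succ s Pl k : k +' o1 <' B -> Ruler B B' s Pl k ->
  Ruler B B' (s +' (k +' o1) *' (Pl *' B)) (Pl *' B) (k +' o1).
Proof.
  intros HkB [H1 [H2 [H3 [H4 [H5 H6]]]]].
  set (Pl' := Pl *' B). set (s' := s +' (k +' o1) *' Pl').
  assert (HPl' : PowB B' Pl') by (apply PowB_mul_B; auto).
  assert (HPlPl' : Pl <' Pl') by (apply lt_mul_B, PowB_pos, H1).
  assert (Hbelow : forall P, PowB B' P -> P <' Pl' -> P <=' Pl)
    by (intros; apply PowB_le_of_lt_mul_B; auto).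
  assert (Hsame : forall P t, PowB B' P -> P <' Pl' -> Digit B s' P t <-> Digit B s P t).
  { intros P t HP HPl.
    split; [apply (Digit_add_higher_inv s P Pl' (k +' o1))|apply Digit_add_higher]; auto. }
  assert (Htop : Digit B s' Pl' (k +' o1)) by (apply Digit_add_top; auto).
  split; [exact HPl'|]. split; [apply add_top_lt; auto|]. split; [exact Htop|]. split.
  { apply Hsame; [apply PowB_1| |exact H4]. eapply le_lt_trans; [apply PowB_ge1, H1|exact HPlPl']. }
  split.
  - intros P HP HPB t Ht. apply Hsame in Ht; auto.
    destruct (Hbelow P HPB HP) as [HPlt| ->].
    + apply Hsame; [apply PowB_mul_B; auto| |apply H5; auto].
      apply (le_lt_trans _ Pl); [apply PowB_mul_B_le; auto|exact HPlPl'].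
    + rewrite (Digit_unique _ _ _ _ _ Ht H3). exact Htop.
  - intros P HP HPB t Ht. destruct HP as [HP| ->].
    + apply Hsame in Ht; auto. destruct (H6 P (Hbelow P HPB HP) HPB t Ht) as [Htk _].
      split; [eapply le_trans; [exact Htk|left; apply lt_succ_diag]|].
      intros ->. exfalso. eapply lt_nle; [apply lt_succ_diag|exact Htk].
    + rewrite (Digit_unique _ _ _ _ _ Ht Htop). split; [apply le_refl|reflexivity].
Qed.

Lemma Ruler_exists a : a <' B -> exists s Pl, Ruler B B' s Pl a.
Proof.
  intro Ha.
  refine (sigma1_ind2_upto (fRuler (tvar 4) (tvar 5) (tvar 1) (tvar 0) (tvar 2))
            (scons B (scons B' e0)) a (fun k s Pl => Ruler B B' s Pl k) _ _ _ _).
  - bounded.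
  - intros k s Pl. apply sat_fRuler.
  - exists z0, o1. apply Ruler_0.
  - intros k Hk [s [Pl HR]]. eexists _, _. apply Ruler_succ; [|exact HR].
    eapply le_lt_trans; [apply lt_le_succ, Hk|exact Ha].
Qed.

Lemma Ruler_place s Pl a i : Ruler B B' s Pl a -> i <=' a ->
  exists P, P <=' Pl /\ PowB B' P /\ Digit B s P i.
Proof.
  intros [H1 [H2 [H3 [H4 [H5 H6]]]]]. revert i.
  induct (fimp (fle (tvar 0) (tvar 1)) (fbex (tplus (tvar 2) tone)
            (fand (fPowB (tvar 6) (tvar 0)) (fDigit (tvar 5) (tvar 4) (tvar 0) (tvar 1)))))
    (scons a (scons Pl (scons s (scons B (scons B' e0))))).
  - setoid_rewrite lt_succ_iff. reflexivity.
  - intros _. exists o1. split; [apply PowB_ge1, H1|]. split; [apply PowB_1|exact H4].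
  - intros i IH Hi. destruct IH as [P [[HP| ->] [HPB HD]]].
    { eapply le_trans; [left; apply lt_succ_diag|exact Hi]. }
    + exists (P *' B). split; [apply PowB_mul_B_le; auto|]. split; [apply PowB_mul_B; auto|].
      apply H5; auto.
    + exfalso. rewrite (Digit_unique _ _ _ _ _ HD H3) in Hi. apply (lt_nle _ _ (lt_succ_diag a) Hi).
Qed.

Section Codes.
Variables a s Pl : N.
Hypothesis Hruler : Ruler B B' s Pl a.
Hypothesis Hcolors : IsColoringSeq M a X0.

Lemma color_lt_B i x y : i <=' a -> x <' y -> exists v, v <' B /\ seqval M X0 i x y v.
Proof.
  intros Hi Hxy. destruct (proj1 (Hcolors i Hi) x y Hxy) as [v [Hv Hxyv]].
  exists v. split; [eapply le_lt_trans; [exact Hv|apply B_gt1]|exact Hxyv].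
Qed.

Lemma Code_1 x y : x <' y -> exists q, Code B B' s o1 q x y.
Proof.
  intro Hxy. destruct (color_lt_B z0 x y (le_0_l a) Hxy) as [v [HvB Hxyv]].
  exists v. split; [rewrite mul_1_l; exact HvB|].
  intros P HP HPB. assert (P = o1) by (apply le_antisym; [exact HP|apply PowB_ge1, HPB]). subst P.
  exists v. split; [apply Digit_1, HvB|]. exists z0. split; [apply Hruler|exact Hxyv].
Qed.

Lemma Code_succ x y q P k : x <' y -> k <' a -> PowB B' P -> P <' Pl -> Digit B s P k ->
  Code B B' s P q x y -> exists v, Code B B' s (P *' B) (q +' v *' (P *' B)) x y.
Proof.
  intros Hxy Hk HP HPl HD [Hq Hplaces].
  destruct Hruler as [_ [_ [_ [_ [Hnext _]]]]].
  destruct (color_lt_B (k +' o1) x y (lt_le_succ _ _ Hk) Hxy) as [v [HvB Hxyv]].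
  assert (HPB : PowB B' (P *' B)) by (apply PowB_mul_B, HP).
  assert (HPPB : P <' P *' B) by (apply lt_mul_B, PowB_pos, HP).
  exists v. split; [apply add_top_lt; auto|].
  intros R HR HRB. destruct HR as [HR| ->].
  - destruct (Hplaces R (PowB_le_of_lt_mul_B R P HRB HP HR) HRB) as [t [Ht Hj]].
    exists t. split; [apply Digit_add_higher; auto|exact Hj].
  - exists v. split; [apply Digit_add_top; auto|].
    exists (k +' o1). split; [apply Hnext; auto|exact Hxyv].
Qed.

Lemma Code_exists x y : x <' y -> exists q, Code B B' s Pl q x y.
Proof.
  intro Hxy. destruct Hruler as [HPl [_ [HDl [HD1 [Hnext Hbound]]]]].
  assert (H : exists q P, PowB B' P /\ P <=' Pl /\ Digit B s P a /\ Code B B' s P q x y).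
  { refine (sigma1_ind2_upto
      (fand (fPowB (tvar 5) (tvar 0)) (fand (fle (tvar 0) (tvar 7))
         (fand (fDigit (tvar 4) (tvar 6) (tvar 0) (tvar 2))
         (fCode (tvar 4) (tvar 5) (tvar 6) (tvar 0) (tvar 1) (tvar 8) (tvar 9)))))
      (scons B (scons B' (scons s (scons Pl (scons x (scons y e0)))))) a
      (fun k q P => PowB B' P /\ P <=' Pl /\ Digit B s P k /\ Code B B' s P q x y) _ _ _ _).
    - bounded.
    - intros k q P. sat_simpl. reflexivity.
    - destruct (Code_1 x y Hxy) as [q Hq].
      exists q, o1. split; [apply PowB_1|]. split; [apply PowB_ge1, HPl|]. split; [exact HD1|exact Hq].
    - intros k Hk [q [P [HP [HPl' [HD Hq]]]]].
      assert (HPlt : P <' Pl).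
      { destruct HPl' as [HPl'| ->]; [exact HPl'|]. exfalso.
        rewrite (Digit_unique _ _ _ _ _ HD HDl) in Hk. eapply lt_irrefl; eauto. }
      destruct (Code_succ x y q P k Hxy Hk HP HPlt HD Hq) as [v Hv].
      eexists _, (P *' B). split; [apply PowB_mul_B, HP|]. split; [apply PowB_mul_B_le; auto|].
      split; [apply Hnext; auto|exact Hv]. }
  destruct H as [q [P [HP [HPl' [HD Hq]]]]].
  rewrite <- (proj2 (Hbound P HPl' HP a HD) eq_refl). exists q. exact Hq.
Qed.

Lemma least_code_coloring : exists G, IsColoring M (Pl *' B) G /\
  forall x y q, x <' y -> colval M G x y q -> Code B B' s Pl q x y.
Proof.
  set (LeastCode x y q := Code B B' s Pl q x y /\ forall q', q' <' q -> ~ Code B B' s Pl q' x y).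
  destruct (triple_comprehension
    (fand (fCode (tvar 3) (tvar 4) (tvar 5) (tvar 6) (tvar 0) (tvar 2) (tvar 1))
       (fball (tvar 0) (fnot (fCode (tvar 4) (tvar 5) (tvar 6) (tvar 7) (tvar 0) (tvar 3) (tvar 2)))))
    (scons B (scons B' (scons s (scons Pl e0)))) LeastCode) as [G HG];
    [bounded | intros x y q; sat_simpl; reflexivity |].
  exists G. split; [split|].
  - intros x y Hxy.
    destruct (least_number (fCode (tvar 1) (tvar 2) (tvar 3) (tvar 4) (tvar 0) (tvar 5) (tvar 6))
      (scons B (scons B' (scons s (scons Pl (scons x (scons y e0)))))) (fun q => Code B B' s Pl q x y))
      as [q Hq]; [bounded | intro q; apply sat_fCode | apply Code_exists, Hxy |].
    exists q. split; [left; apply Hq|]. apply HG, Hq.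
  - intros x y v w _ Hv Hw. apply HG in Hv. apply HG in Hw.
    destruct (lt_trichotomy v w) as [H|[H|H]]; [exfalso; apply (proj2 Hw v H), Hv | exact H |].
    exfalso; apply (proj2 Hv w H), Hw.
  - intros x y q _ Hq. apply HG, Hq.
Qed.

Lemma Code_transfer q x y x' y' i u : i <=' a -> x <' y ->
  Code B B' s Pl q x y -> Code B B' s Pl q x' y' -> seqval M X0 i x y u -> seqval M X0 i x' y' u.
Proof.
  intros Hi Hxy [_ Hc] [_ Hc'] Hu.
  destruct (Ruler_place s Pl a i Hruler Hi) as [P [HPl [HP HD]]].
  destruct (Hc P HPl HP) as [t [Ht [j [Hj Hxyt]]]].
  destruct (Hc' P HPl HP) as [t' [Ht' [j' [Hj' Hxyt']]]].
  rewrite (Digit_unique _ _ _ _ _ Hj HD) in Hxyt.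
  rewrite (Digit_unique _ _ _ _ _ Hj' HD), (Digit_unique _ _ _ _ _ Ht' Ht) in Hxyt'.
  rewrite (proj2 (Hcolors i Hi) x y u t Hxy Hu Hxyt). exact Hxyt'.
Qed.

End Codes.
End PowersOfB.

Lemma indicator_colorings a : exists G, IsColoringSeq M a G /\
  forall i x y, seqval M G i x y z0 <-> ~ colval M X0 x y i.
Proof.
  destruct (triple_comprehension
    (f_or (fand (feq (tvar 0) tone) (fmem (tpair (tvar 1) (tvar 2)) 0))
          (fand (feq (tvar 0) tzero) (fnot (fmem (tpair (tvar 1) (tvar 2)) 0)))) e0
    (fun i w v => (v = o1 /\ mem M (pair M w i) X0) \/ (v = z0 /\ ~ mem M (pair M w i) X0)))
    as [G HG]; [bounded | reflexivity |].
  pose proof one_neq_zero.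
  exists G. split.
  - intros i _. split.
    + intros x y _. destruct (classic (colval M X0 x y i)); [exists o1|exists z0];
        (split; [apply le_refl || apply le_0_l | apply HG; auto]).
    + intros x y v w _ Hv Hw. apply HG in Hv. apply HG in Hw.
      destruct Hv as [[-> ?]|[-> ?]], Hw as [[-> ?]|[-> ?]]; tauto.
  - intros i x y. unfold seqval. rewrite HG. unfold colval. intuition congruence.
Qed.

Lemma fallow_of_transitive : EMx M ->
  forall a, IsColoring M a X0 -> exists X, Infinite M X /\ FallowOn M (colval M X0) X.
Proof.
  intros Hem a [Hc Hfun]. destruct (indicator_colorings a) as [G [HG Hzero]].
  destruct (Hem a G HG) as [X [HX Htrans]]. exists X. split; [exact HX|].
  intros x y z u v w Hx Hy Hz Hxy Hyz Hu Hv Hw.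
  assert (Hxz : x <' z) by (eapply lt_trans; eauto).
  destruct (Hc x z Hxz) as [w' [Hwa Hw']]. rewrite (Hfun x z w w' Hxz Hw Hw') in *.
  apply NNPP. intro Hne.
  assert (Hxy0 : seqval M G w' x y z0)
    by (apply Hzero; intro H; apply Hne; left; exact (Hfun x y _ _ Hxy H Hu)).
  assert (Hyz0 : seqval M G w' y z z0)
    by (apply Hzero; intro H; apply Hne; right; exact (Hfun y z _ _ Hyz H Hv)).
  exact (proj1 (Hzero w' x z) (Htrans w' Hwa x y z z0 Hx Hy Hz Hxy Hyz Hxy0 Hyz0) Hw').
Qed.

Lemma base_exists a : exists B B', B = B' +' o1 /\ Pow2 B /\ z0 <' B' /\ a <' B.
Proof.
  destruct (Pow2_exists (a +' o1)) as [B [HPow2 HaB]].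
  assert (HB1 : o1 <' B) by (eapply le_lt_trans; [|exact HaB]; rewrite add_comm; apply le_add).
  destruct (pos_succ B (lt_trans _ _ _ lt_0_1 HB1)) as [B' HB'].
  exists B, B'. split; [exact HB'|]. split; [exact HPow2|]. split.
  - destruct (le_0_l B') as [H| <-]; [exact H|]. rewrite HB', add_0_l in HB1.
    now apply lt_irrefl in HB1.
  - eapply lt_trans; [apply lt_succ_diag|exact HaB].
Qed.

Lemma transitive_of_fallow : fEMfin M ->
  forall a, IsColoringSeq M a X0 ->
  exists X, Infinite M X /\ forall i, le M i a -> TransitiveOn M (seqval M X0 i) X.
Proof.
  intros Hf a Ha.
  destruct (base_exists a) as [B [B' [HB' [Pow2_B [HB'pos HaB]]]]].
  destruct (Ruler_exists B B' HB' Pow2_B HB'pos a HaB) as [s [Pl Hruler]].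
  destruct (least_code_coloring B B' HB' Pow2_B HB'pos a s Pl Hruler Ha) as [G [HG Hcode]].
  destruct (Hf _ G HG) as [X [HX Hfallow]]. exists X. split; [exact HX|].
  intros i Hi x y z u Hx Hy Hz Hxy Hyz Hu1 Hu2.
  assert (Hxz : x <' z) by (eapply lt_trans; eauto).
  destruct HG as [Hc _].
  destruct (Hc x y Hxy) as [q1 [_ Hq1]]. destruct (Hc y z Hyz) as [q2 [_ Hq2]].
  destruct (Hc x z Hxz) as [q3 [_ Hq3]].
  destruct (Hfallow x y z q1 q2 q3 Hx Hy Hz Hxy Hyz Hq1 Hq2 Hq3) as [->| ->].
  - exact (Code_transfer B B' HB' Pow2_B HB'pos a s Pl Hruler Ha q1 x y x z i u Hi Hxy
             (Hcode _ _ _ Hxy Hq1) (Hcode _ _ _ Hxz Hq3) Hu1).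
  - exact (Code_transfer B B' HB' Pow2_B HB'pos a s Pl Hruler Ha q2 y z x z i u Hi Hyz
             (Hcode _ _ _ Hyz Hq2) (Hcode _ _ _ Hxz Hq3) Hu2).
Qed.

End Model.

Theorem mainTheorem4 :
  forall M : L2structure, RCA0model M -> (EMx M <-> fEMfin M).
Proof.
  intros M [HB [HI HC]]. split.
  - intros Hem a F HF. exact (fallow_of_transitive M HB HI HC F Hem a HF).
  - intros Hfem a F HF. exact (transitive_of_fallow M HB HI HC F Hfem a HF).
Qed.
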